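(* Let $u,v\geq 3$ be integers and let $M=\begin{bmatrix} a & b\\ c & d\end{bmatrix}\in\mathscr{G}_{u,v}$. Then $(f\circ C)(c/a)$ satisfies the $(v,u)$-divisibility property if and only if $(f\circ C)(b/d)$ satisfies the $(u,v)$-divisibility property.
   Context: Let $$\mathscr{G}_{u,v}=\left\{\begin{bmatrix}1+uvn_1 & vn_2\\ un_3 & 1+uvn_4\end{bmatrix}\in SL_2(\mathbb{Z}) : (n_1,n_2,n_3,n_4)\in\mathbb{Z}^4\right\}.$$ For integers $q_0,\dots,q_r$, $[q_0,q_1,\dots,q_r]$ denotes the (possibly undefined) continued fraction $q_0+\cfrac{1}{q_1+\cfrac{1}{\ddots+\cfrac{1}{q_r}}}$. Let $A=\bigcup_{r\geq 0}(\mathbb{Z}\times\mathbb{Z}_{\neq 0}^r)$, with elements written $\llbracket q_0,\dots,q_r\rrbracket$. Let $A_0=\{\llbracket q_0,\dots,q_r\rrbracket\in A : [q_i,\dots,q_r]\neq 0\text{ when }0<i<r\}$, $A_1=\{\llbracket q_0,\dots,q_r\rrbracket\in A_0 : q_i\geq 1\text{ when }0<i<r,\text{ and }q_r>1\text{ when }r>0\}$, $A_2=\{\llbracket q_0,\dots,q_r\rrbracket\in A_0 : |q_i|>1\text{ when }0<i\leq r\}$. Every rational $x$ has a unique representation $x=[x_0,\dots,x_r]$ with $\llbracket x_0,\dots,x_r\rrbracket\in A_1$ (the short continued fraction representation); $C:\mathbb{Q}\to A_1$ is defined by $C(x)=\llbracket x_0,\dots,x_r\rrbracket$. Set $-\llbracket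 q_0,\dots,q_r\rrbracket:=\llbracket -q_0,\dots,-q_r\rrbracket$. Define $\llbracket q_0,\dots,q_m\rrbracket\oplus\llbracket p_0,\dots,p_n\rrbracket$ to be $\llbracket q_0,\dots,q_m,p_0,\dots,p_n\rrbracket$ if $p_0\neq 0$, and $\llbracket q_0,\dots,q_{m-1},q_m+p_1,p_2,\dots,p_n\rrbracket$ if $p_0=0$ (only used with $n\geq 1$). Define $f:A_1\to A_2$ recursively: $f(\llbracket q_0,\dots,q_r\rrbracket)=\llbracket q_0,\dots,q_r\rrbracket$ if $r=0$ or $q_i\neq 1$ for all $0<i<r$; otherwise, with $j$ the smallest index with $0<j<r$ and $q_j=1$, $$f(\llbracket q_0,\dots,q_r\rrbracket)=\llbracket q_0,\dots,q_{j-2},q_{j-1}+1\rrbracket\oplus -f(\llbracket q_{j+1}+1,q_{j+2},\dots,q_r\rrbracket).$$ For positive integers $s,t$, a sequence $\llbracket q_0,\dots,q_r\rrbracket\in A$ satisfies the $(s,t)$-divisibility property if $t\mid q_i$ for every even index $i$ and $s\mid q_i$ for every odd index $i$. *)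

(* Defs.v *)
From mathcomp Require Import all_boot all_order all_algebra.
From mathcomp Require Import zify ring lra.
Set Implicit Arguments.
Unset Strict Implicit.
Unset Printing Implicit Defensive.
Import Order.TTheory GRing.Theory Num.Theory.
Local Open Scope ring_scope.

Definition Guv (u v : int) (M : 'M[int]_2) : Prop :=
  \det M = 1 /\
  exists n1 n2 n3 n4 : int,
    [/\ M 0 0 = 1 + u * v * n1, M 0 1 = v * n2,
        M 1 0 = u * n3 & M 1 1 = 1 + u * v * n4].

(* [None] stands for an undefined continued fraction. *)
Fixpoint cfval (q : seq int) : option rat :=
  match q with
  | [::] => None
  | q0 :: q' =>
      if q' is [::] then Some q0%:~R
      else if cfval q' is Some x then
             if x == 0 then None else Some (q0%:~R + x^-1)
           else None
  end.

(* The index r of the last entry of q_0, ..., q_r. *)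
Definition lasti (q : seq int) : nat := (size q).-1.

Definition inA (q : seq int) : bool :=
  (q != [::]) && all (fun z => z != 0) (behead q).

(* The tails with 0 < i < r being nonzero forces all of them to be defined, so
   it does not matter here that an undefined tail counts as "nonzero". *)
Definition inA0 (q : seq int) : bool :=
  inA q && [forall i : 'I_(lasti q),
              (0 < i)%N ==> (cfval (drop i q) != Some 0)].

Definition inA1 (q : seq int) : bool :=
  [&& inA0 q,
      [forall i : 'I_(lasti q), (0 < i)%N ==> (1 <= q`_i)] &
      (0 < lasti q)%N ==> (1 < q`_(lasti q))].

Definition inA2 (q : seq int) : bool :=
  inA0 q && [forall i : 'I_(lasti q).+1, (0 < i)%N ==> (1 < `|q`_i|)].

Record A1 := MkA1 { seq_of_A1 :> seq int; A1P : inA1 seq_of_A1 }.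
Record A2 := MkA2 { seq_of_A2 :> seq int; A2P : inA2 seq_of_A2 }.

Definition pos_tail (t : seq int) : bool :=
  (t == [::]) || (all (fun z => 1 <= z) t && (1 < last 0 t)).

Lemma cfval_cons h t x : t != [::] -> cfval t = Some x -> x != 0 ->
  cfval (h :: t) = Some (h%:~R + x^-1).
Proof. by case: t => // k t _ /= -> /negbTE ->. Qed.

Lemma cfval_pos t : t != [::] -> pos_tail t ->
  exists2 x, cfval t = Some x & 1 < x.
Proof.
elim: t => // h [|k t] IH _ /=.
  by rewrite /pos_tail /= => /andP[_ h1]; exists h%:~R => //; rewrite ltr1z.
rewrite /pos_tail /= => /andP[/and3P[h1 k1 t1] l1].
have [|x Ex x1] := IH isT; first by rewrite /pos_tail /= k1 t1.
have x0 : x != 0 by rewrite gt_eqF // (lt_trans _ x1).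
exists (h%:~R + x^-1); first exact: (cfval_cons h _ Ex x0).
have : 0 < x^-1 by rewrite invr_gt0 (lt_trans _ x1).
have : (1 : rat) <= h%:~R by rewrite ler1z.
lra.
Qed.

Lemma cfval_big t : t != [::] -> all (fun z : int => 1 < `|z|) t ->
  exists2 x, cfval t = Some x & 1 < `|x|.
Proof.
elim: t => // h [|k t] IH _ /=.
  by rewrite andbT => h1; exists h%:~R => //; rewrite -intr_norm ltr1z.
move=> /andP[h1 t1]; have [//|x Ex x1] := IH isT.
have x0 : x != 0 by rewrite -normr_gt0 (lt_trans _ x1).
exists (h%:~R + x^-1); first exact: (cfval_cons h _ Ex x0).
have ix : `|x^-1| < 1 by rewrite normfV invf_lt1 // (lt_trans _ x1).
have h2 : (2 : rat) <= `|h%:~R| by rewrite -intr_norm (ler_int _ 2); lia.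
have := lerB_normD h%:~R x^-1; lra.
Qed.

Lemma forall_nth_behead (P : pred int) h t :
  [forall i : 'I_(size t).+1, (0 < i)%N ==> P (h :: t)`_i] = all P t.
Proof.
apply/forallP/(all_nthP 0) => [H i it | H [[|i] it] //=]; last exact: H.
by have := H (Ordinal (it : (i.+1 < (size t).+1)%N)).
Qed.

Lemma inA1_cons h t : inA1 (h :: t) = pos_tail t.
Proof.
apply/idP/idP.
  case: t => [|k t] // /and3P[_ /forallP H1 /= H2].
  rewrite /pos_tail /=; apply/andP; split; last first.
    by move: H2; rewrite (last_nth 0).
  change (all (fun z => 1 <= z) (k :: t)).
  apply/(all_nthP 0) => i; rewrite /= ltnS leq_eqVlt => /orP[/eqP -> | it].
    exact: ltW.
  by have := H1 (Ordinal (it : (i.+1 < (size t).+1)%N)).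
move=> Ht; have [-> | t0] := eqVneq t [::].
  rewrite /inA1 /inA0 /inA /lasti /= andbT.
  by apply/andP; split; apply/forallP => -[].
have Hall : all (fun z => 1 <= z) t && (1 < last 0 t).
  by move: Ht; rewrite /pos_tail (negbTE t0).
case/andP: Hall => Hall Hlast.
apply/and3P; split.
- apply/andP; split.
    rewrite /inA /=; apply/allP => z /(allP Hall); lia.
  apply/forallP => -[[|i] it] //=.
  rewrite /lasti /= in it.
  have dn : drop i t != [::] by rewrite -size_eq0 size_drop subn_eq0 -ltnNge ltnW.
  have [|x -> x1] := @cfval_pos (drop i t) dn.
    rewrite /pos_tail (negbTE dn) /=; apply/andP; split.
      by apply/allP => z /mem_drop /(allP Hall).
    rewrite -(cat_take_drop i t) last_cat in Hlast.
    by case: (drop i t) dn Hlast.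
  by apply/eqP => -[xE]; rewrite xE in x1.
- apply/forallP => -[[|i] it] //=.
  by rewrite /lasti /= in it; apply: (all_nthP 0 Hall); apply: ltnW.
- by case: t {Ht t0 Hall} Hlast => // k t; rewrite (last_nth 0).
Qed.

Lemma inA2_cons h t : inA2 (h :: t) = all (fun z : int => 1 < `|z|) t.
Proof.
rewrite /inA2 /lasti /= (forall_nth_behead (fun z : int => 1 < `|z|)).
apply/andb_idl => Hall; apply/andP; split.
  rewrite /inA /=; apply/allP => z /(allP Hall); lia.
apply/forallP => -[[|i] it] //=; rewrite /lasti /= in it.
have dn : drop i t != [::] by rewrite -size_eq0 size_drop subn_eq0 -ltnNge ltnW.
have [|x -> x1] := @cfval_big (drop i t) dn.
  by apply/allP => z /mem_drop /(allP Hall).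
by apply/eqP => -[xE]; rewrite xE normr0 in x1.
Qed.

Lemma A1_ex_nat (b : nat) (a : int) : (0 < b)%N ->
  exists q, inA1 q && (cfval q == Some (a%:~R / b%:R)).
Proof.
elim/ltn_ind: b a => b IH a b0.
have bZ : (b%:Z != 0) by lia.
have E := divz_eq a b%:Z; have r0 := modz_ge0 a bZ.
have rb : (a %% b%:Z)%Z < b%:Z by apply: ltz_pmod.
set k := (a %/ b)%Z in E; set r := (a %% b)%Z in E r0 rb.
have bR : (b%:R : rat) != 0 by rewrite pnatr_eq0 -lt0n.
have [rz | rnz] := eqVneq r 0.
  exists [:: k]; rewrite inA1_cons /= E rz addr0 intrM /=.
  by apply/eqP; congr Some; rewrite mulfK.
have rE : r = (absz r)%:Z by lia.
have rn : (0 < absz r)%N by lia.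
have rR : ((absz r)%:R : rat) != 0 by rewrite pnatr_eq0 -lt0n.
have rltb : (absz r < b)%N by lia.
have [[|h t] // /andP[H1 /eqP H2]] := IH _ rltb b%:Z rn.
have brat : (1 : rat) < b%:Z%:~R / (absz r)%:R.
  by rewrite ltr_pdivlMr ?ltr0n // mul1r -[b%:Z%:~R]/(b%:R) ltr_nat.
exists [:: k, h & t]; apply/andP; split; last first.
  apply/eqP; rewrite (cfval_cons k _ H2) //; last first.
    by rewrite gt_eqF // (lt_trans _ brat).
  congr Some; rewrite E intrD intrM [in RHS]rE.
  rewrite -[b%:Z%:~R]/(b%:R) -[(absz r)%:Z%:~R]/((absz r)%:R).
  by field; rewrite bR rR.
rewrite inA1_cons.
rewrite inA1_cons in H1.
have [tz | tn] := eqVneq t [::].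
  rewrite tz /= in H2; case: H2 => H2.
  by rewrite tz /pos_tail /= -H2 in brat *; rewrite ltr1z in brat; lia.
have [x Ex x1] := cfval_pos tn H1.
have x0 : x != 0 by rewrite gt_eqF // (lt_trans _ x1).
rewrite (cfval_cons h tn Ex x0) in H2; case: H2 => H2; rewrite -H2 in brat.
have ix : x^-1 < 1 by rewrite invf_lt1 // (lt_trans _ x1).
have h1 : 1 <= h by rewrite -gtz0_ge1 -(ltr0z rat); lra.
move: H1; rewrite /pos_tail; case/orP => [|/andP[]]; first by case: (t) tn.
rewrite /= h1 => -> /=.
by case: t tn {Ex H2}.
Qed.

Lemma A1_ex (x : rat) : exists q, inA1 q && (cfval q == Some x).
Proof.
have dE : denq x = (absz (denq x))%:Z by have := denq_gt0 x; lia.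
have [|q Hq] := @A1_ex_nat (absz (denq x)) (numq x).
  by have := denq_gt0 x; lia.
exists q; move: Hq; rewrite -[(absz (denq x))%:R]/((absz (denq x))%:Z%:~R) -dE.
by rewrite divq_num_den.
Qed.

Lemma A1_uniq q1 q2 : inA1 q1 -> inA1 q2 -> cfval q1 = cfval q2 -> q1 = q2.
Proof.
elim: q1 q2 => [|h1 t1 IH] [|h2 t2] //; rewrite !inA1_cons => P1 P2.
have aux h t : pos_tail t -> exists e : rat,
  [/\ cfval (h :: t) = Some (h%:~R + e), 0 <= e, e < 1,
      (t == [::]) = (e == 0) & t != [::] -> cfval t = Some e^-1].
  have [-> _ | tn Pt] := eqVneq t [::].
    by exists 0; split => //=; rewrite addr0.
  have [x Ex x1] := cfval_pos tn Pt.
  have xp : 0 < x by rewrite (lt_trans _ x1).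
  exists x^-1; split.
  - by rewrite (cfval_cons h tn Ex) // gt_eqF.
  - by rewrite invr_ge0 ltW.
  - by rewrite invf_lt1.
  - by rewrite invr_eq0 (gt_eqF xp); case: (t) tn.
  - by rewrite invrK.
have [e1 [-> a1 b1 c1 d1]] := aux h1 t1 P1.
have [e2 [-> a2 b2 c2 d2]] := aux h2 t2 P2.
case=> Es.
have hE : h1 = h2.
  have k1 : h1 < h2 + 1 by rewrite -(ltr_int rat) intrD; lra.
  have k2 : h2 < h1 + 1 by rewrite -(ltr_int rat) intrD; lra.
  lia.
have eE : e1 = e2 by rewrite hE in Es; lra.
rewrite hE; congr cons.
have [t1z | t1n] := eqVneq t1 [::].
  by move: c1; rewrite t1z eqxx eE -c2 => /esym/eqP.
have t2n : t2 != [::] by rewrite c2 -eE -c1.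
apply: IH; last by rewrite d1 // d2 // eE.
- by case: t1 t1n P1 {d1 c1} => // k t _; rewrite inA1_cons /pos_tail /=;
    case: t => //= k' t /andP[/and3P[_ -> ->] ->].
- by case: t2 t2n P2 {d2 c2} => // k t _; rewrite inA1_cons /pos_tail /=;
    case: t => //= k' t /andP[/and3P[_ -> ->] ->].
Qed.

(* The short continued fraction; unique by [A1_uniq]. *)
Definition shortcf (x : rat) : A1 :=
  MkA1 (proj1 (andP (xchooseP (A1_ex x)))).

Lemma shortcfP (x : rat) : cfval (shortcf x) = Some x.
Proof. by apply/eqP; case/andP: (xchooseP (A1_ex x)). Qed.

Definition oppcf (q : seq int) : seq int := [seq - z | z <- q].

(* When q = [::], or when p = [:: 0], the value is irrelevant. *)
Definition oplus (q p : seq int) : seq int :=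
  match p with
  | p0 :: p1 :: p' =>
      if p0 == 0 then rcons (take (lasti q) q) (q`_(lasti q) + p1) ++ p'
      else q ++ p
  | _ => q ++ p
  end.

(* [n] bounds the depth of the recursion, and [size q] suffices; [j] is the
   least positive index with q_j = 1, or [size q] if there is none. *)
Fixpoint f_rec (n : nat) (q : seq int) : seq int :=
  if n is n'.+1 then
    let j := (index 1 (behead q)).+1 in
    if (j < lasti q)%N then
      oplus (rcons (take j.-1 q) (q`_j.-1 + 1))
            (oppcf (f_rec n' ((q`_j.+1 + 1) :: drop j.+2 q)))
    else q
  else q.

Definition f_seq (q : seq int) : seq int := f_rec (size q) q.

Lemma f_rec_stable n m q : (size q <= n)%N -> (size q <= m)%N ->
  f_rec n q = f_rec m q.
Proof.
elim: n m q => [|n IH] [|m] q //=; try by case: q.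
move=> qn qm; case: ifP => // jq; congr (oplus _ (oppcf _)).
apply: IH; rewrite /= size_drop; rewrite /lasti in jq; lia.
Qed.

Lemma f_seqE q :
  f_seq q =
    let j := (index 1 (behead q)).+1 in
    if (j < lasti q)%N then
      oplus (rcons (take j.-1 q) (q`_j.-1 + 1))
            (oppcf (f_seq ((q`_j.+1 + 1) :: drop j.+2 q)))
    else q.
Proof.
case: q => // h t; rewrite {1}/f_seq /=; case: ifP => // jq.
congr (oplus _ (oppcf _)).
apply: f_rec_stable; rewrite //= size_drop; rewrite /lasti /= in jq; lia.
Qed.

Lemma f_seq_shape h t : pos_tail t -> exists h' t',
  [/\ f_seq (h :: t) = h' :: t', h <= h' &
      all (fun z : int => 1 < `|z|) t'].
Proof.
move: {2}(size t).+1 (ltnSn (size t)) => n.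
elim: n h t => // n IH h t; rewrite ltnS => tn Pt.
rewrite f_seqE /= /lasti /=; case: ifP => jt; last first.
  exists h, t; split=> //; case/orP: Pt => [/eqP -> // | /andP[Hall Hlast]].
  apply/allP => z zt; have z1 := allP Hall _ zt.
  suff : z != 1 by lia.
  apply/eqP => zE; subst z.
  have ilt : (index (1 : int) t < size t)%N by rewrite index_mem.
  have E : (index (1 : int) t).+1 = size t by apply/eqP; rewrite eqn_leq ilt leqNgt jt.
  have := nth_index 0 zt.
  rewrite -[index (1 : int) t]/((index (1 : int) t).+1.-1) E nth_last => lE; by rewrite lE in Hlast.
have t1 : (1 : int) \in t by rewrite -index_mem ltnW.
have tn0 : t != [::] by case: (t) t1.
move: Pt; rewrite /pos_tail (negbTE tn0) /=.
have n1 : (1 : int) \notin take (index (1 : int) t) t.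
  by rewrite in_take_leq ?ltnn // index_size.
have tE : t = take (index (1 : int) t) t ++ 1 :: drop (index (1 : int) t).+1 t.
  by rewrite -{1}(cat_take_drop (index (1 : int) t) t) (drop_nth 0) ?nth_index ?index_mem.
set i := index (1 : int) t in jt n1 tE *.
have si : size (take i t) = i by rewrite size_takel // /i index_size.
have w0 : drop i.+1 t != [::] by rewrite -size_eq0 size_drop subn_eq0 -ltnNge.
have wn : (size (drop i.+1 t) <= n)%N by rewrite size_drop; lia.
have -> : t`_i.+1 = head 0 (drop i.+1 t) by rewrite -nth0 nth_drop addn0.
have -> : drop i.+2 t = behead (drop i.+1 t) by rewrite -drop1 drop_drop add1n.
move: (take i t) (drop i.+1 t) n1 tE si w0 wn => s w n1 tE si w0 wn.
rewrite {1}tE tE all_cat last_cat => /andP[/and3P[Hs _ Hw]] /=.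
clearbody i; clear tE.
case: w w0 Hw wn => // k w _ /= /andP[k1 Hw] wn Hlast.
have [||h' [t' [-> hh Ht']]] := IH (k + 1) w.
- lia.
- by apply/orP; case: w Hlast Hw {wn} => [|k' w] Hlast Hw; [left|right; apply/andP].
rewrite /oppcf map_cons.
have Hopp : all (fun z : int => 1 < `|z|) [seq - z | z <- t'].
  by rewrite all_map; apply/allP => z /(allP Ht') /=; rewrite normrN.
have Hs2 : all (fun z : int => 1 < `|z|) s.
  apply/allP => z zs; have := allP Hs _ zs.
  by have : z != 1 by [apply: contraNneq n1 => <-]; lia.
have -> : forall a : seq int, oplus a (- h' :: [seq - z | z <- t'])
    = a ++ - h' :: [seq - z | z <- t'].
  move=> a; have /negbTE h0 : - h' != 0 by lia.
  by rewrite /oplus; case: map => // z t1'; rewrite h0.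
have Hh : (1 < `|- h'|) by lia.
have -> : take i (h :: s ++ 1 :: k :: w) = take i (h :: s).
  by rewrite -cat_cons takel_cat //= si.
have -> : (h :: s ++ 1 :: k :: w)`_i = (h :: s)`_i.
  by rewrite -cat_cons nth_cat /= si ltnS leqnn.
case/lastP: s si Hs Hs2 {n1} => [|s l] si Hs Hs2.
  rewrite -si /=; exists (h + 1), (- h' :: [seq - z | z <- t']).
  split; [by []|lia|by rewrite /= Hh].
rewrite size_rcons in si; rewrite -si /= nth_rcons ltnn eqxx.
have -> : take (size s) (rcons s l) = s by rewrite -cats1 take_size_cat.
exists h, (rcons s (l + 1) ++ - h' :: [seq - z | z <- t']); split => //.
rewrite all_cat /= Hh Hopp andbT all_rcons.
move: Hs Hs2; rewrite !all_rcons => /andP[l1 _] /andP[_ ->]; lia.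
Qed.

Lemma f_seq_A2 q : inA1 q -> inA2 (f_seq q).
Proof.
case: q => // h t; rewrite inA1_cons => /(f_seq_shape h) [h' [t' [-> _]]].
by rewrite inA2_cons.
Qed.

Definition f (q : A1) : A2 := MkA2 (f_seq_A2 (A1P q)).

Definition divisibility_property (s t : int) (q : seq int) : Prop :=
  forall i : nat, (i < size q)%N ->
    if odd i then (s %| q`_i)%Z else (t %| q`_i)%Z.

(* Main.v *)
Require Import Defs.
From mathcomp Require Import all_boot all_order all_algebra.
From mathcomp Require Import zify ring lra.
Set Implicit Arguments.
Unset Strict Implicit.
Unset Printing Implicit Defensive.
Import Order.TTheory GRing.Theory Num.Theory.
Local Open Scope ring_scope.

(** Call an expansion [q_0, ..., q_r] thick when |q_i| >= 3 for i > 0.  As u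
    and v are at least 3, an expansion in A2 with the divisibility property is
    thick, its entries after the first being nonzero multiples of u or v.

    The map f is value-preserving ([cfval_f_seq]), and every thick expansion
    is the image under f of the short expansion with the same value
    ([f_seq_preimage]).  Since short expansions are unique, f(C(x)) is any
    thick expansion of x that exists.  Hence f(C(x)) has the divisibility
    property if and only if x has some thick expansion with that property
    ([f_shortcfP]), and f and C disappear from the problem.

    Suppose now that c/a = [q_0, ..., q_r] is thick, with u dividing the q_i
    of even index and v those of odd index.  The product P of the elementary
    matrices L^{q_0} U^{q_1} L^{q_2} ..., with L = [1 0; 1 1] and
    U = [1 1; 0 1], lies in the group G_{u,v}.  If r were odd, (a, c) would be
    proportional to the second column of P, forcing v to divide a, against
    a = 1 mod uv.  So r is even, (a, c) is the first column of P, and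
    M = P U^k with v dividing k.  Reading off the second column,
    d/b = [q_0, ..., q_r, k], which collapses to [q_0, ..., q_{r-1}] when
    k = 0 (or b = 0 if moreover r = 0).  [second_column] carries this out by
    peeling off L^{q_0} U^{q_1} repeatedly.  Inverting d/b prepends a 0, or
    removes q_0 when q_0 = 0; either way the parities of the indices are
    exchanged, which is why u and v are too ([div_transfer]).

    The converse is the same implication for [d c; b a], which is in
    G_{v,u}. *)

(** * Values of continued fractions *)

Notation thick_tail := (all (fun z : int => 2 < `|z|)).

Lemma thick_tail_cfval t : t != [::] -> thick_tail t ->
  exists2 x, cfval t = Some x & x != 0.
Proof.
move=> t0 t3; have t2 : all (fun z : int => 1 < `|z|) t.
  by apply: sub_all t3 => z; lia.
have [x Ex x1] := cfval_big t0 t2.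
by exists x => //; rewrite -normr_gt0 (lt_trans _ x1).
Qed.

Lemma cfval_opp q x : cfval q = Some x -> cfval (oppcf q) = Some (- x).
Proof.
elim: q x => // h [|k t] IH x; first by case=> <- /=; rewrite rmorphN.
rewrite /= in IH *.
case: (if _ is [::] then _ else _) IH => // y /(_ y erefl) ->.
by rewrite oppr_eq0; case: eqP => // _ [<-]; rewrite rmorphN /= invrN opprD.
Qed.

Lemma cfval_head_add h t m y :
  cfval (h :: t) = Some y -> cfval (h + m :: t) = Some (y + m%:~R).
Proof.
rewrite /=; case: t => [|z s]; first by case=> <-; rewrite intrD.
by case: (cfval _) => // w; case: eqP => // _ [<-]; rewrite intrD addrAC.
Qed.

(** * The map f *)

Lemma oplus_cons h q p : q != [::] -> oplus (h :: q) p = h :: oplus q p.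
Proof.
by case: q => // k q _; case: p => [|p0 [|p1 p]] //=; case: ifP.
Qed.

Lemma oplus_cat q h p : h != 0 -> oplus q (h :: p) = q ++ h :: p.
Proof. by case: p => //= k p /negbTE ->. Qed.

(** With [f_seq_one], this turns the definition of f, which searches for the
    first 1, into a recursion on the leading entries. *)
Lemma f_seq_cons h k t : k != 1 -> f_seq [:: h, k & t] = h :: f_seq (k :: t).
Proof.
move=> k1; rewrite f_seqE [in RHS]f_seqE /= (negbTE k1) /lasti /=.
rewrite ltnS; case: ifP => // _.
by rewrite oplus_cons //; case: (index _ t).
Qed.

Lemma f_seq_one h k t : 1 <= k -> pos_tail t ->
  f_seq [:: h, 1, k & t] = h + 1 :: oppcf (f_seq (k + 1 :: t)).
Proof.
move=> k1 Pt; rewrite f_seqE /= drop0.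
have [h' [t' [-> hh' _]]] := f_seq_shape (k + 1) Pt.
have h0 : - h' != 0 by lia.
by rewrite oplus_cat // h0.
Qed.

Lemma pos_tail_cons k t :
  pos_tail (k :: t) = [&& 1 <= k, pos_tail t & (t == [::]) ==> (1 < k)].
Proof.
rewrite /pos_tail; case: t => [|z t] /=; last by rewrite andbT -!andbA.
by rewrite andbT.
Qed.

(** Each rewriting step preserves the value because
    h + 1/(1 + 1/y) = (h + 1) - 1/(y + 1), where y = [k', ...] and hence
    y + 1 = [k' + 1, ...]. *)
Lemma cfval_f_seq h t : pos_tail t -> cfval (f_seq (h :: t)) = cfval (h :: t).
Proof.
have [n] := ubnP (size t); elim: n h t => // n IH h [|k t] // /ltnSE tn Pkt.
move: (Pkt); rewrite pos_tail_cons => /and3P[k1 Pt tk].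
have [kE|kn1] := eqVneq k 1; last first.
  have [x Ex x1] := @cfval_pos (k :: t) isT Pkt.
  have Ef : cfval (f_seq (k :: t)) = Some x by rewrite IH.
  have x0 : x != 0 by rewrite gt_eqF // (lt_trans _ x1).
  rewrite f_seq_cons // (cfval_cons h _ Ef) ?(cfval_cons h _ Ex) //.
  by have [h' [t' [->]]] := f_seq_shape k Pt.
rewrite kE in Pkt tk *; clear k1.
case: t Pt tn tk Pkt => [|k' t] // Pt tn _ Pkt.
move: (Pt); rewrite pos_tail_cons => /and3P[k1 Pt' _].
have [y Ey y1] := @cfval_pos (k' :: t) isT Pt.
have Ez : cfval (k' + 1 :: t) = Some (y + 1) := cfval_head_add 1 Ey.
have Ef : cfval (f_seq (k' + 1 :: t)) = Some (y + 1).
  by rewrite IH //; apply: ltnW tn.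
have y0 : y != 0 by rewrite gt_eqF // (lt_trans _ y1).
have z0 : y + 1 != 0 by rewrite gt_eqF //; lra.
have Ew := cfval_cons 1 (isT : k' :: t != [::]) Ey y0.
have w0 : 1%:~R + y^-1 != 0.
  by rewrite gt_eqF // addr_gt0 // invr_gt0 (lt_trans _ y1).
rewrite f_seq_one // (cfval_cons (h + 1) _ (cfval_opp Ef)) ?oppr_eq0 //.
  rewrite (cfval_cons h _ Ew) //; congr Some; rewrite intrD.
  by field; rewrite y0 z0.
by have [h' [t' [->]]] := f_seq_shape (k' + 1) Pt'.
Qed.

(** Undoes f one entry at a time.  If the entry k after h is positive, h is kept
    and the rest is treated recursively.  If k is negative and the opposite of
    the rest comes from [k', s], the identity
    h - 1/(y + 1) = (h - 1) + 1/(1 + 1/y), with y = [k' - 1, s], gives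
    [h - 1, 1, k' - 1, s].  The last two conclusions make the induction work:
    they and |k| >= 3 ensure that k' is at least 2, so that f does not act at
    k' and k' - 1 is an admissible entry, and that k' - 1 is at least 2 when
    it is the last entry. *)
Lemma f_seq_preimage h t : thick_tail t -> exists h' s,
  [/\ pos_tail s, cfval (h' :: s) = cfval (h :: t), f_seq (h' :: s) = h :: t,
      h - 1 <= h' & s = [::] -> h' = h].
Proof.
have [n] := ubnP (size t); elim: n h t => // n IH h [|k t].
  by exists h, [::]; split=> //; lia.
move=> /ltnSE tn /andP[k3 t3].
have [kp|kn] := lerP 0 k.
  have [k' [s [Ps Es Fs kk' k'E]]] := IH k t tn t3.
  exists h, (k' :: s); split; [| |rewrite f_seq_cons ?Fs //; lia|lia|by []].
    by rewrite pos_tail_cons Ps; case: eqP => [/k'E|]; lia.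
  have [x Ex x0] := @thick_tail_cfval (k :: t) isT (introT andP (conj k3 t3)).
  by rewrite (cfval_cons h _ Ex) // (@cfval_cons h (k' :: s) x) // Es.
have t3' : thick_tail (oppcf t).
  by rewrite all_map; apply: sub_all t3 => z /=; rewrite normrN.
have k3' : 2 < `|- k| by rewrite normrN.
have [|k' [s [Ps Es Fs kk' k'E]]] := IH (- k) (oppcf t) _ t3'.
  by rewrite size_map.
have Pks : pos_tail (k' - 1 :: s).
  by rewrite pos_tail_cons Ps; case: eqP => [/k'E|]; lia.
exists (h - 1), [:: 1, k' - 1 & s]; split; [| | |lia|by []].
- by rewrite pos_tail_cons Pks.
- have [y Ey y1] := @cfval_pos (k' - 1 :: s) isT Pks.
  have Ez : cfval (k' :: s) = Some (y + 1).
    by have := cfval_head_add 1 Ey; rewrite subrK.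
  have Ekt : cfval (k :: t) = Some (- (y + 1)).
    have /cfval_opp : cfval (oppcf (k :: t)) = Some (y + 1) by rewrite -Ez Es.
    by rewrite /oppcf mapK //; apply: opprK.
  have y0 : y != 0 by rewrite gt_eqF // (lt_trans _ y1).
  have z0 : y + 1 != 0 by rewrite gt_eqF //; lra.
  have Ew := cfval_cons 1 (isT : k' - 1 :: s != [::]) Ey y0.
  have w0 : 1%:~R + y^-1 != 0.
    by rewrite gt_eqF // addr_gt0 // invr_gt0 (lt_trans _ y1).
  rewrite (cfval_cons _ _ Ew) // (cfval_cons _ _ Ekt) ?oppr_eq0 //.
  by congr Some; rewrite intrB; field; rewrite y0 z0.
- rewrite f_seq_one //; last by lia.
  by rewrite !addrNK Fs /oppcf /= opprK mapK //; apply: opprK.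
Qed.

Lemma f_shortcf_thick_tail h t x : thick_tail t -> cfval (h :: t) = Some x ->
  seq_of_A2 (f (shortcf x)) = h :: t.
Proof.
move=> /(f_seq_preimage h) [h' [s [Ps Es Fs _ _]]] Ex.
have As : inA1 (h' :: s) by rewrite inA1_cons.
rewrite -Fs -(A1_uniq (A1P (shortcf x)) As) //.
by rewrite shortcfP Es.
Qed.

(** * The divisibility property *)

Lemma div_cons s t h q :
  divisibility_property s t (h :: q) <->
  (t %| h)%Z /\ divisibility_property t s q.
Proof.
split=> [H | [Hh Hq] [|i] // /Hq /=]; last by case: (odd i).
split; first exact: (H 0).
by move=> i /(H i.+1) /=; case: (odd i).
Qed.

Lemma dvdz_norm_gt2 (s z : int) : 3 <= s -> (s %| z)%Z -> z != 0 -> 2 < `|z|.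
Proof.
move=> s3 sz z0; have := @dvdn_leq `|s|%N `|z|%N _ sz.
by rewrite absz_gt0 => /(_ z0); lia.
Qed.

Lemma div_thick_tail (s t : int) q : 3 <= s -> 3 <= t ->
  divisibility_property s t q -> all (fun z => z != 0) q -> thick_tail q.
Proof.
elim: q s t => //= z q IH s t s3 t3 /div_cons[tz Dq] /andP[z0 q0].
by rewrite (IH t s) // andbT (dvdz_norm_gt2 t3).
Qed.

(** This eliminates f and C: the right-hand side speaks of an arbitrary
    expansion, which can be produced without knowing how f computes it. *)
Lemma f_shortcfP (s t : int) x : 3 <= s -> 3 <= t ->
  divisibility_property s t (f (shortcf x)) <->
  exists h q, [/\ cfval (h :: q) = Some x, thick_tail q &
                  divisibility_property s t (h :: q)].
Proof.
move=> s3 t3; split=> [|[h [q [Ex q3 D]]]]; last first.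
  by rewrite (f_shortcf_thick_tail q3 Ex).
rewrite -[seq_of_A2 _]/(f_seq (shortcf x)).
have := A1P (shortcf x); have := shortcfP x.
case: (seq_of_A1 _) => // h w Ex; rewrite inA1_cons => Pw.
have Ef := cfval_f_seq h Pw; have [h' [q [Fq _ q2]]] := f_seq_shape h Pw.
rewrite Fq in Ef * => D; exists h', q; split; rewrite ?Ef //.
move: D => /div_cons[_ D]; apply: (div_thick_tail _ _ D) => //.
by apply: sub_all q2 => z; lia.
Qed.

(** * From the first column of a matrix to the second *)

(** Membership of [a b; c d] in G_{u,v}, entry by entry: peeling off an
    elementary matrix is then a substitution on four integers. *)
Definition in_Guv (u v a b c d : int) : Prop :=
  a * d - b * c = 1 /\
  [/\ (u * v %| a - 1)%Z, (v %| b)%Z, (u %| c)%Z & (u * v %| d - 1)%Z].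

Lemma eq1_mod_uv (u v a : int) : 3 <= u -> 3 <= v -> (u * v %| a - 1)%Z ->
  [/\ a != 0, a != -1 & ~~ (v %| a)%Z].
Proof.
move=> u3 v3 ha.
have va : (v %| a - 1)%Z by apply: dvdz_trans ha; rewrite dvdz_mull.
split.
- by apply/eqP => aE; move: (dvdz_norm_gt2 v3 va); rewrite aE; lia.
- by apply/eqP => aE; move: (dvdz_norm_gt2 v3 va); rewrite aE; lia.
- apply/negP => va'; have : (v %| a - (a - 1))%Z by rewrite rpredB.
  by rewrite subKr => /(dvdz_norm_gt2 v3)/(_ isT).
Qed.

(** Induction on the expansion of c/a, replacing M by U^{-k} L^{-h} M, whose
    first column has ratio [l, ...] when c/a = [h, k, l, ...].  The new
    expansion keeps the first entry h so that, when l is put back behind k,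
    it still is a multiple of u of absolute value at least 3. *)
Lemma second_column (u v a b c d h : int) (t : seq int) :
  3 <= u -> 3 <= v -> in_Guv u v a b c d -> thick_tail t ->
  divisibility_property v u (h :: t) ->
  cfval (h :: t) = Some (c%:~R / a%:~R) ->
  b = 0 \/ exists t', [/\ b != 0, thick_tail t',
     divisibility_property v u (h :: t') &
     cfval (h :: t') = Some (d%:~R / b%:~R)].
Proof.
have [n] := ubnP (size t); elim: n h t a b c d => // n IH h t a b c d + u3 v3 G.
have [Gdet [Ga Gb Gc Gd]] := G.
have [a0 am1 va] := eq1_mod_uv u3 v3 Ga.
have aR : a%:~R != 0 :> rat by rewrite intr_eq0.
rewrite ltnS => tn t3 D Ex.
have {D} [uh D] := (div_cons _ _ _ _).1 D.
have [->|b0] := eqVneq b 0; [by left | right].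
have bR : b%:~R != 0 :> rat by rewrite intr_eq0.
case: t tn t3 D Ex => [|k [|l t]] tn t3 D Ex.
(* c/a = [h] : here M = L^h U^b *)
- have cE : c = h * a.
    by apply: (@intr_inj rat); rewrite intrM; case: Ex => ->; rewrite divfK.
  have a1 : a = 1.
    have : (a %| 1)%Z.
      apply/dvdzP; exists (d - b * h); apply/esym.
      by rewrite -[RHS]Gdet cE; ring.
    by move: am1; clear; rewrite dvdz1; lia.
  exists [:: b]; split=> //.
  + by rewrite /= andbT (dvdz_norm_gt2 v3).
  + by do 2!(apply/div_cons; split=> //).
  + rewrite (@cfval_cons h [:: b] b%:~R) //; congr Some.
    have -> : d = 1 + b * h by rewrite -[X in X + _]Gdet cE a1; ring.
    by rewrite intrD intrM; field.
(* c/a = [h, k] is impossible, since v divides k but not a *)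
- have {D} [vk _] := (div_cons _ _ _ _).1 D.
  have k0 : k%:~R != 0 :> rat.
    by rewrite intr_eq0; case/andP: t3 => + _; apply: contraTneq => ->.
  move: Ex; rewrite (@cfval_cons h [:: k] k%:~R) // => -[Ex].
  case/negP: va; suff -> : a = (c - h * a) * k by rewrite dvdz_mull.
  apply: (@intr_inj rat); rewrite !(intrM, intrB).
  by rewrite -(divfK aR c%:~R) -Ex; field.
have {D} [vk D] := (div_cons _ _ _ _).1 D.
have /andP[k3 lt3] := t3.
have [y Ey y0] := @thick_tail_cfval (l :: t) isT lt3.
have [x Ex' x0] := @thick_tail_cfval [:: k, l & t] isT t3.
have xE : x = k%:~R + y^-1 by move: Ex'; rewrite (cfval_cons k _ Ey) // => -[].
move: Ex; rewrite (cfval_cons h _ Ex') // => -[cE].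
set c' := c - h * a; set d' := d - h * b.
set a' := a - k * c'; set b' := b - k * d'.
have c'E : c'%:~R = a%:~R / x.
  by rewrite !(intrM, intrB) -(divfK aR c%:~R) -cE; ring.
have G' : in_Guv u v a' b' c' d'.
  split; first by rewrite -Gdet /a' /b' /c' /d'; ring.
  have uc' : (u %| c')%Z by rewrite rpredB // dvdz_mulr.
  have uvkc' : (u * v %| k * c')%Z by rewrite mulrC dvdz_mul.
  have uvhb : (u * v %| h * b)%Z by rewrite dvdz_mul.
  split; rewrite // /a' /b' /d'.
  - by rewrite addrAC rpredB.
  - by rewrite rpredB // dvdz_mulr.
  - by rewrite addrAC rpredB.
have [_ [Ga' _ _ _]] := G'.
have [a'0 _ _] := eq1_mod_uv u3 v3 Ga'.
have a'E : a'%:~R = a%:~R / (x * y).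
  rewrite intrB intrM c'E.
  have -> : k%:~R = x - y^-1 by rewrite xE addrK.
  by field; rewrite x0 y0.
have Ey' : cfval (l :: t) = Some (c'%:~R / a'%:~R).
  by rewrite Ey c'E a'E; congr Some; field; rewrite aR x0 y0.
have dE : d = d' + h * b by rewrite subrK.
have bE : b = b' + k * d' by rewrite subrK.
clearbody a' b' c' d'.
have l3 : 2 < `|l| by case/andP: lt3.
have {}t3 : thick_tail t by case/andP: lt3.
have [b'0|[t' [b'0 t'3 D' Ed]]] :=
  IH l t a' b' c' d' (ltnW tn) u3 v3 G' t3 D Ey'.
  (* M is L^h U^k L^l, hence d/b = [h, k] *)
  exists [:: k]; split=> //.
  - by rewrite /= k3.
  - by do 2!(apply/div_cons; split=> //).
  - have k0 : k%:~R != 0 :> rat by rewrite intr_eq0; apply: contraTneq k3 => ->.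
    rewrite (@cfval_cons h [:: k] k%:~R) //; congr Some.
    rewrite b'0 add0r in bE.
    have d'0 : d'%:~R != 0 :> rat.
      by rewrite intr_eq0; apply: contraNneq b0 => d'0; rewrite bE d'0 mulr0.
    by rewrite dE bE !(intrM, intrD); field; rewrite k0 d'0.
exists [:: k, l & t']; split=> //.
- by rewrite /= k3 l3.
- by do 2!(apply/div_cons; split=> //).
have b'R : b'%:~R != 0 :> rat by rewrite intr_eq0.
have lt'3 : thick_tail (l :: t') by rewrite /= l3.
have klt'3 : thick_tail [:: k, l & t'] by rewrite /= k3 l3.
have [z Ez z0] := @thick_tail_cfval (l :: t') isT lt'3.
have zE : z = d'%:~R / b'%:~R by move: Ed; rewrite Ez => -[].
have [w Ew w0] := @thick_tail_cfval [:: k, l & t'] isT klt'3.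
have d'R : d'%:~R != 0 :> rat.
  by move: z0; rewrite zE mulf_eq0 negb_or => /andP[].
have wE : w = b%:~R / d'%:~R.
  move: Ew; rewrite (cfval_cons k _ Ez) // => -[<-].
  by rewrite bE zE !(intrM, intrD); field; rewrite b'R d'R.
rewrite (cfval_cons h _ Ew) //; congr Some.
by rewrite wE {1}dE !(intrM, intrD); field; rewrite bR d'R.
Qed.

(** Inverting the expansion of d/b shifts the indices by one.  It prepends a 0,
    divisible by v, to h, ...; a nonzero h then has absolute value at least 3,
    being a multiple of u, as required of an entry that is no longer first. *)
Lemma div_transfer (u v a b c d : int) : 3 <= u -> 3 <= v ->
  in_Guv u v a b c d ->
  divisibility_property v u (f (shortcf (c%:~R / a%:~R))) ->
  divisibility_property u v (f (shortcf (b%:~R / d%:~R))).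
Proof.
move=> u3 v3 G /(f_shortcfP _ v3 u3) [h [t [Ex t3 D]]].
apply/(f_shortcfP _ u3 v3).
have [_ [_ _ _ /(eq1_mod_uv u3 v3)[d0 _ _]]] := G.
have [-> | [t' [b0 t3' D' Ey]]] := second_column u3 v3 G t3 D Ex.
  exists 0, [::]; split; rewrite //= ?mul0r //.
  by apply/div_cons; rewrite dvdz0.
have dR : d%:~R != 0 :> rat by rewrite intr_eq0.
have bR : b%:~R != 0 :> rat by rewrite intr_eq0.
have [hE | h0] := eqVneq h 0.
  rewrite hE in D' Ey; case/div_cons: D' => _ D'.
  case: t' t3' D' Ey => [|k t'] t3' D' Ey.
    case: Ey => /eqP.
    by rewrite eq_sym mulf_eq0 invr_eq0 (negbTE dR) (negbTE bR).
  exists k, t'; split => //; last by case/andP: t3'.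
  have [x Ex' x0] := @thick_tail_cfval (k :: t') isT t3'.
  move: Ey; rewrite (cfval_cons 0 _ Ex') // add0r Ex' => -[E].
  by rewrite -(invrK x) E invf_div.
exists 0, (h :: t'); split.
- rewrite (cfval_cons 0 _ Ey) ?add0r ?invf_div //.
  by rewrite mulf_neq0 ?invr_eq0.
- by case/div_cons: D' => uh _; rewrite /= t3' (dvdz_norm_gt2 u3).
- by apply/div_cons; split; rewrite ?dvdz0.
Qed.

Lemma det_mx2 (R : comNzRingType) (M : 'M[R]_2) :
  \det M = M 0 0 * M 1 1 - M 0 1 * M 1 0.
Proof.
rewrite (expand_det_row _ 0) !big_ord_recl big_ord0 /cofactor.
rewrite !det_mx11 !mxE /= expr0 expr1 addr0 mul1r mulN1r mulrN.
by congr (M _ _ * M _ _ - M _ _ * M _ _); apply: val_inj.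
Qed.

Theorem proposition4 (u v : int) (M : 'M[int]_2)
    (a := M 0 0) (b := M 0 1) (c := M 1 0) (d := M 1 1) :
  3 <= u -> 3 <= v -> Guv u v M ->
  (divisibility_property v u ((f \o shortcf) (c%:~R / a%:~R)) <->
   divisibility_property u v ((f \o shortcf) (b%:~R / d%:~R))).
Proof.
move=> u3 v3 [Mdet [n1 [n2 [n3 [n4 [Ea Eb Ec Ed]]]]]].
have G : in_Guv u v a b c d.
  split; first by rewrite -Mdet det_mx2.
  by split; rewrite ?/a ?/b ?/c ?/d ?Ea ?Eb ?Ec ?Ed ?(addrC 1) ?addrK dvdz_mulr.
split; first exact: div_transfer.
(* exchanging both rows and columns of M exchanges u and v *)
apply: div_transfer => //; case: G => Gdet [Ga Gb Gc Gd].
split; first by rewrite -Gdet; ring.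
by split; rewrite // mulrC.
Qed.
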